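(* Let $G$ be a weakly branch group acting on a rooted tree $T$, let $H\leq G$ be a prodense subgroup of $G$, and let $u\in T$ be any vertex. Then $H$ is a proper subgroup of $G$ if and only if $H_u$ is a proper subgroup of $G_u$.
   Context: All rooted trees are infinite and locally finite. For a rooted tree $T$, the $n$-th level $L_n$ is the set of vertices at distance $n$ from the root, and for vertices $v,w$ one writes $v\leq w$ if $v$ lies on the simple path from the root to $w$; $T_v$ is the subtree with vertex set $\{w : v\leq w\}$, rooted at $v$. $T$ is spherically homogeneous if all vertices of the same level have the same degree. $\mathrm{Aut}(T)$ is the group of automorphisms of $T$ fixing the root. For $G\leq \mathrm{Aut}(T)$ and a vertex $v$, $\mathrm{St}_G(v)$ is the stabiliser of $v$ in $G$, and $\varphi_v:\mathrm{St}_{\mathrm{Aut}(T)}(v)\to \mathrm{Aut}(T_v)$ is the homomorphism restricting the action to $T_v$. Put $G_v=\varphi_v(\mathrm{St}_G(v))\leq \mathrm{Aut}(T_v)$; likewise $H_v=\varphi_v(\mathrm{St}_H(v))$ for any subgroup $H\leq G$. The rigid stabiliser $\mathrm{Rist}_G(v)$ is the subgroup of all $g\in G$ fixing every vertex outside $T_v$. A weakly branch group acting on $T$ is a subgroup $G\leq\mathrm{Aut}(T)$, with $T$ a spherically homogeneous rooted tree, such that $G$ acts transitively on every level $L_n$ and $\mathrm{Rist}_G(v)\neq\{1\}$ for every vertex $v$. A subgroup $H$ of a group $G$ is prodense if $HN=G$ for every non-trivial normal subgroup $N\trianglelefteq G$. *)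

(* Defs.v *)
From HB Require Import structures.
From mathcomp Require Import all_boot.
From mathcomp Require Import boolp classical_sets functions cardinality.

Set Implicit Arguments.
Unset Strict Implicit.
Unset Printing Implicit Defensive.

Local Open Scope classical_set_scope.
Local Open Scope card_scope.
Local Open Scope group_scope.

Section Subgroups.
Variable gT : groupType.
Implicit Types G H N : set gT.

Definition subgroup H G := group_closed (mem H) /\ H `<=` G.

Definition proper_subgroup H G := subgroup H G /\ H <> G.

Definition normal_subgroup N G :=
  subgroup N G /\ forall g n, G g -> N n -> N (n ^ g).

Definition prodense H G :=
  forall N, normal_subgroup N G -> N <> [set 1] ->
    [set h * n | h in H & n in N] = G.

End Subgroups.

Record rootedGraph := RootedGraph {
  vertex :> choiceType;
  adj : rel vertex;
  root : vertex
}.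
Arguments root : clear implicits.

Section Trees.
Variable T : rootedGraph.
Implicit Types (x y v w : T) (p : seq T).

(* As in [path], the walk x :: p is given by its origin x and its tail p. *)
Definition walk x y p := path (@adj T) x p /\ last x p = y.

Definition simple_path x y p := walk x y p /\ uniq (x :: p).

Definition distance x y (n : nat) :=
  (exists2 p, walk x y p & size p = n) /\
  (forall p, walk x y p -> (n <= size p)%N).

Definition level (n : nat) : set T := [set v | distance (root T) v n].

Definition neighbours v : set T := [set w | adj v w].

Definition tree :=
  [/\ symmetric (@adj T), irreflexive (@adj T)
    & forall x y, exists! p, simple_path x y p].

Definition locally_finite := forall v, finite_set (neighbours v).

Definition spherically_homogeneous :=
  forall n v w, level n v -> level n w -> neighbours v #= neighbours w.

Definition vle v w :=
  exists2 p, simple_path (root T) w p & v \in root T :: p.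

Definition descendants v : set T := [set w | vle v w].

(* Automorphisms carry their inverse; the remaining fields being proofs, two
   automorphisms are equal as soon as they agree at every vertex (autP). *)
Record aut := Aut {
  aut_fun :> T -> T;
  aut_inv : T -> T;
  aut_funK : cancel aut_fun aut_inv;
  aut_invK : cancel aut_inv aut_fun;
  aut_adj : forall x y, adj (aut_fun x) (aut_fun y) = adj x y;
  aut_root : aut_fun (root T) = root T
}.

Lemma autP (f g : aut) : f =1 g -> f = g.
Proof.
case: f g => [f f' fK f'K fa fr] [g g' gK g'K ga gr] /= /funext fg.
subst g; have fg' : f' = g' by apply/funext => x; rewrite -[in LHS](g'K x) fK.
by subst g'; congr Aut; exact: Prop_irrelevance.
Qed.

Lemma aut_inv_adj (f : aut) x y : adj (aut_inv f x) (aut_inv f y) = adj x y.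
Proof. by rewrite -(aut_adj f) !aut_invK. Qed.

Lemma aut_inv_root (f : aut) : aut_inv f (root T) = root T.
Proof. by rewrite -[in LHS](aut_root f) aut_funK. Qed.

Definition aut_one : aut :=
  @Aut id id (fun=> erefl) (fun=> erefl) (fun _ _ => erefl) erefl.

Definition aut_V (f : aut) : aut :=
  Aut (@aut_invK f) (@aut_funK f) (aut_inv_adj f) (aut_inv_root f).

Lemma aut_comp_adj (f g : aut) x y : adj (f (g x)) (f (g y)) = adj x y.
Proof. by rewrite !aut_adj. Qed.

Lemma aut_comp_root (f g : aut) : f (g (root T)) = root T.
Proof. by rewrite !aut_root. Qed.

Definition aut_mul (f g : aut) : aut :=
  Aut (can_comp (@aut_funK f) (@aut_funK g))
    (can_comp (@aut_invK g) (@aut_invK f))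
    (aut_comp_adj f g) (aut_comp_root f g).

Lemma aut_mulA : associative aut_mul. Proof. by move=> f g h; exact: autP. Qed.

Lemma aut_mul1 : left_id aut_one aut_mul. Proof. by move=> f; exact: autP. Qed.

Lemma aut_mulr1 : right_id aut_one aut_mul.
Proof. by move=> f; exact: autP. Qed.

Lemma aut_mulV : left_inverse aut_one aut_V aut_mul.
Proof. by move=> f; apply: autP => x; exact: aut_funK. Qed.

Lemma aut_mulrV : right_inverse aut_one aut_V aut_mul.
Proof. by move=> f; apply: autP => x; exact: aut_invK. Qed.

HB.instance Definition _ := gen_eqMixin aut.
HB.instance Definition _ := gen_choiceMixin aut.
HB.instance Definition _ :=
  isGroup.Build aut aut_mulA aut_mul1 aut_mulr1 aut_mulV aut_mulrV.

Lemma vle_aut (g : aut) v w : vle v w -> vle (g v) (g w).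
Proof.
move=> [p [[pp <-] up] vp]; exists (map g p).
  split; first split.
  - rewrite -(aut_root g) path_map; apply: sub_path pp => x y /=.
    by rewrite aut_adj.
  - by rewrite -[in LHS](aut_root g) last_map.
  - rewrite -[X in X :: _](aut_root g) -map_cons map_inj_uniq //.
    exact: can_inj (@aut_funK g).
by rewrite -[X in X :: _](aut_root g) -map_cons map_f.
Qed.

End Trees.

Record rootedTree := RootedTree {
  tree_graph :> rootedGraph;
  tree_graph_tree : tree tree_graph;
  tree_graph_infinite : infinite_set [set: tree_graph];
  tree_graph_locally_finite : locally_finite tree_graph
}.

Section RootedTrees.
Variable T : rootedTree.
Implicit Types (v w : T) (g h : aut T) (G H : set (aut T)).

Lemma vle_refl v : vle v v.
Proof.
have [_ _ /(_ (root T) v) [p [pv _]]] := tree_graph_tree T.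
by exists p => //; case: pv => -[_ <-] _; exact: mem_last.
Qed.

Definition subtree_root v : descendants v := SigSub (mem_set (vle_refl v)).

Definition subtree v : rootedGraph :=
  @RootedGraph (descendants v) (fun x y => adj (\val x) (\val y))
    (subtree_root v).

Lemma descendants_aut v g (gv : g v = v) (w : subtree v) :
  g (\val w) \in descendants v.
Proof.
apply/mem_set; have /set_mem/(vle_aut g) := valP w.
by rewrite gv.
Qed.

Definition restr_fun v g (gv : g v = v) (w : subtree v) : subtree v :=
  SigSub (descendants_aut gv w).

Lemma aut_inv_fix v g : g v = v -> g^-1 v = v.
Proof. by move=> gv; rewrite -[in LHS]gv; exact: aut_funK. Qed.

Lemma restr_funK v g (gv : g v = v) :
  cancel (restr_fun gv) (restr_fun (aut_inv_fix gv)).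
Proof. by move=> w; apply: val_inj; exact: aut_funK. Qed.

Lemma restr_invK v g (gv : g v = v) :
  cancel (restr_fun (aut_inv_fix gv)) (restr_fun gv).
Proof. by move=> w; apply: val_inj; exact: aut_invK. Qed.

Lemma restr_adj v g (gv : g v = v) (x y : subtree v) :
  adj (restr_fun gv x) (restr_fun gv y) = adj x y.
Proof. exact: aut_adj. Qed.

Lemma restr_root v g (gv : g v = v) :
  restr_fun gv (root (subtree v)) = root (subtree v).
Proof. exact: val_inj. Qed.

Definition restr v g (gv : g v = v) : aut (subtree v) :=
  Aut (restr_funK gv) (restr_invK gv) (restr_adj gv) (restr_root gv).

Lemma restrM v g h (gv : g v = v) (hv : h v = v) (ghv : (g * h) v = v) :
  restr ghv = restr gv * restr hv.
Proof. by apply: autP => w; exact: val_inj. Qed.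

Definition vertex_stab G v : set (aut T) := [set g | G g /\ g v = v].

Definition vertex_section G v : set (aut (subtree v)) :=
  [set h | exists g (gS : vertex_stab G v g), h = restr (proj2 gS)].

Definition rist G v : set (aut T) :=
  [set g | G g /\ forall w, ~ descendants v w -> g w = w].

Definition level_transitive G :=
  forall n v w, level n v -> level n w -> exists2 g, G g & g v = w.

Definition weakly_branch G :=
  [/\ spherically_homogeneous T, group_closed (mem G), level_transitive G
    & forall v, rist G v <> [set 1]].

End RootedTrees.

Arguments vertex_section {T} G v.

(* Main.v *)
(* Let n be the level of u. Being prodense, H is dense in G for the congruence
   topology, hence transitive on level n, and H_u = G_u gives H_v = G_v for all
   v on that level. It suffices that some Rist_H(v) be non-trivial with v on
   level n: writing g in G as h k with h in H and k fixing level n, and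
   replacing k by an element of H with the same section, one sees that Rist_H(v)
   lies in the core of H in G, a normal subgroup N of G contained in H, so that
   H = H N = G.

   Assume all these Rist_H(v) trivial, and take a minimal set S of vertices of
   level n such that the group K_S of elements of H fixing the n-ball and
   supported below S is non-trivial. Fix v in S. An element of K_S is trivial as
   soon as its section at v is, and a non-trivial one moves something outside
   T_v. Commutators with elements of H_v = G_v show that, for every p >= v
   moved by K_S, the sections at v of K_S contain all the second iterated
   commutators of Rist_G(p); some two of them do not commute. Take p moved
   moreover by some g in Rist_G(v), b1 and b2 in K_S realising non-commuting such
   sections, and h in H close to g. Then [b1, b2^h] is trivial on T_v, the
   sections having disjoint supports, hence trivial, although outside T_v it
   coincides with [b1, b2] up to a prescribed depth: a contradiction. *)
Require Import Defs.
From HB Require Import structures.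
From mathcomp Require Import all_boot.
From mathcomp Require Import boolp classical_sets functions cardinality.

Set Implicit Arguments.
Unset Strict Implicit.
Unset Printing Implicit Defensive.

Local Open Scope classical_set_scope.
Local Open Scope group_scope.

(** * Closure rules for subgroups given as sets *)

Section GroupClosed.
Variables (gT : groupType) (H : set gT).
Hypothesis cH : group_closed (mem H).

Lemma closed1 : H 1. Proof. exact: (set_mem cH.1). Qed.

Lemma closedV x : H x -> H x^-1.
Proof. by move=> Hx; apply/set_mem/(group_closedV cH)/mem_set. Qed.

Lemma closedM x y : H x -> H y -> H (x * y).
Proof. by move=> Hx Hy; apply/set_mem/(group_closedM cH); exact: mem_set. Qed.

Lemma closedJ x y : H x -> H y -> H (x ^ y).
Proof.
by move=> Hx Hy; rewrite conjgE; do ?apply: closedM => //; exact: closedV.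
Qed.

Lemma closedR x y : H x -> H y -> H [~ x, y].
Proof. by move=> Hx Hy; apply: closedM; [exact: closedV | exact: closedJ]. Qed.

End GroupClosed.

Lemma group_closedP (gT : groupType) (H : set gT) :
  H 1 -> (forall x, H x -> H x^-1) -> (forall x y, H x -> H y -> H (x * y)) ->
  group_closed (mem H).
Proof.
move=> H1 HV HM; split; first exact: mem_set.
by move=> x y /set_mem Hx /set_mem Hy; apply/mem_set/HM => //; exact: HV.
Qed.

(** * Root paths, depth and finite balls *)

Section TreePaths.
Variable T : rootedTree.
Implicit Types (v w x y p q : T).

Fact root_path_exists x : exists s, simple_path (Defs.root T) x s.
Proof.
by have [_ _ /(_ (Defs.root T) x) [s [sx _]]] := tree_graph_tree T; exists s.
Qed.

Definition root_path x : seq T := projT1 (cid (root_path_exists x)).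

Definition depth x := size (root_path x).

Lemma root_pathP x : simple_path (Defs.root T) x (root_path x).
Proof. exact: (projT2 (cid (root_path_exists x))). Qed.

Lemma root_path_unique x s : simple_path (Defs.root T) x s -> root_path x = s.
Proof.
have [_ _ /(_ (Defs.root T) x) [t [_ t_unique]]] := tree_graph_tree T.
by move=> /t_unique <-; rewrite (t_unique _ (root_pathP x)).
Qed.

Lemma last_root_path x : last (Defs.root T) (root_path x) = x.
Proof. by have [[]] := root_pathP x. Qed.

Lemma root_path_inj : injective root_path.
Proof. by move=> x y xy; rewrite -(last_root_path x) xy last_root_path. Qed.

Lemma root_path_last x s1 s2 :
  root_path x = s1 ++ s2 -> root_path (last (Defs.root T) s1) = s1.
Proof.
move=> xE; apply: root_path_unique.
have [[+ _] +] := root_pathP x; rewrite xE cat_path -cat_cons cat_uniq.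
by move=> /andP[? _] /andP[? _]; split.
Qed.

Lemma vleP v w : vle v w <-> exists s, root_path w = root_path v ++ s.
Proof.
split=> [[s /root_path_unique <- {s}]|[s wE]].
  move=> vs; case/splitPl wE: (root_path w) / vs => [s1 s2 <-].
  by exists s2; rewrite (root_path_last wE).
exists (root_path w); first exact: root_pathP.
by rewrite wE -cat_cons mem_cat -[X in X \in _]last_root_path mem_last.
Qed.

Lemma vle_trans v w x : vle v w -> vle w x -> vle v x.
Proof.
move=> /vleP[s wE] /vleP[t xE]; apply/vleP; exists (s ++ t).
by rewrite xE wE catA.
Qed.

Lemma vle_depth v w : vle v w -> (depth v <= depth w)%N.
Proof. by move=> /vleP[s wE]; rewrite /depth wE size_cat leq_addr. Qed.

Lemma vle_depth_eq v w x : depth v = depth w -> vle v x -> vle w x -> v = w.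
Proof.
move=> vw /vleP[s xE] /vleP[t]; rewrite xE => /eqP.
by rewrite eqseq_cat // => /andP[/eqP/root_path_inj].
Qed.

Lemma ancestor x n : (n <= depth x)%N -> exists2 v, vle v x & depth v = n.
Proof.
move=> nx; have xE := esym (cat_take_drop n (root_path x)).
exists (last (Defs.root T) (take n (root_path x))).
  by apply/vleP; exists (drop n (root_path x)); rewrite (root_path_last xE).
by rewrite /depth (root_path_last xE) size_takel.
Qed.

(** Any walk from the root shortens to a simple path, which is the root path by uniqueness. *)
Lemma level_depth x : level (depth x) x.
Proof.
split; first by exists (root_path x); have [] := root_pathP x.
move=> s [+ <-]; case/shortenP => t t_path t_uniq ts.
have -> : depth (last (Defs.root T) t) = size t.
  by rewrite /depth (@root_path_unique _ t).
by apply: uniq_leq_size => //; case/andP: t_uniq.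
Qed.

Lemma aut_root_path (g : aut T) x : root_path (g x) = map g (root_path x).
Proof.
apply: root_path_unique; have [[x_path x_last] x_uniq] := root_pathP x.
have gr := aut_root g; split; first split.
- rewrite -[X in path _ X]gr path_map; apply: sub_path x_path => y z /=.
  by rewrite aut_adj.
- by rewrite -[X in last X]gr last_map x_last.
- rewrite -[X in X :: _]gr -map_cons map_inj_uniq //.
  exact: can_inj (@aut_funK _ g).
Qed.

Lemma depth_aut (g : aut T) x : depth (g x) = depth x.
Proof. by rewrite /depth aut_root_path size_map. Qed.

Lemma depth_eq0 x : depth x = 0 -> x = Defs.root T.
Proof. by move/size0nil => x0; rewrite -(last_root_path x) x0. Qed.

Lemma finite_ball n : finite_set [set x : T | (depth x <= n)%N].
Proof.
elim: n => [|n IHn].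
  apply: (@sub_finite_set _ _ [set Defs.root T]); last exact: finite_set1.
  by move=> x /=; rewrite leqn0 => /eqP/depth_eq0.
pose B := [set x : T | (depth x <= n)%N].
apply: (@sub_finite_set _ _ (B `|` \bigcup_(y in B) neighbours y)); last first.
  rewrite finite_setU; split=> //; apply: bigcup_finite => // y _.
  exact: tree_graph_locally_finite.
move=> x /= xn; have [xn'|nx] := leqP (depth x) n; [by left|right].
have [[]] := root_pathP x; move: nx xn; rewrite /depth.
move xE: (root_path x) => t; case/lastP: t xE => // s z xE.
rewrite size_rcons rcons_path last_rcons => ns sn /andP[_ zs] <- _.
exists (last (Defs.root T) s) => //=.
by rewrite /B /= /depth (@root_path_last x _ [:: z]) // xE cats1.
Qed.

Lemma exists_deep n : exists x : T, (n <= depth x)%N.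
Proof.
apply: contrapT => /forallNP noT; apply: (tree_graph_infinite (r := T)).
apply: sub_finite_set (finite_ball n) => x _ /=.
by rewrite ltnW // ltnNge; apply/negP.
Qed.

End TreePaths.

(** * Supports, sections and commutators of automorphisms *)

Section Supports.
Variable T : rootedTree.
Implicit Types (v w x y p q : T) (a b g h r t : aut T) (G : set (aut T)).

Lemma aut_mulE g h x : (g * h) x = g (h x). Proof. by []. Qed.

Lemma aut_VK g : cancel g (g^-1)%g. Proof. exact: aut_funK. Qed.

Lemma aut_KV g : cancel (g^-1)%g g. Proof. exact: aut_invK. Qed.

Lemma vle_autE g v w : vle (g v) (g w) <-> vle v w.
Proof. by split=> [/(vle_aut g^-1)|/(vle_aut g)//]; rewrite !aut_VK. Qed.

Definition supported p r := forall x, ~ vle p x -> r x = x.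

Definition agree v g h := forall x, vle v x -> g x = h x.

Lemma supported_fix p r : supported p r -> r p = p.
Proof.
move=> rp; have [prp|/rp/(can_inj (aut_VK r))//] := pselect (vle p (r p)).
by apply: vle_depth_eq (vle_refl _) prp; rewrite depth_aut.
Qed.

Lemma supported_stable p r x : supported p r -> vle p (r x) <-> vle p x.
Proof. by move=> /supported_fix rp; rewrite -[X in vle X (r x)]rp vle_autE. Qed.

Lemma supported_vle p q r : vle p q -> supported q r -> supported p r.
Proof. by move=> pq rq x px; apply: rq => /(vle_trans pq). Qed.

Lemma supported_above p v r : vle v p -> supported p r -> r v = v.
Proof. by move=> vp rp; apply: supported_fix; exact: supported_vle rp. Qed.

Lemma supportedV p r : supported p r -> supported p r^-1.
Proof. by move=> rp x /rp rx; rewrite -[in LHS]rx aut_VK. Qed.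

Lemma supportedM p r t : supported p r -> supported p t -> supported p (r * t).
Proof. by move=> rp tp x px; rewrite aut_mulE tp // rp. Qed.

Lemma supportedJ p r g : supported p r -> supported (g^-1 p) (r ^ g).
Proof.
move=> rp x px; rewrite conjgE !aut_mulE rp ?aut_VK // => pgx.
by apply: px; rewrite -[x](aut_VK g) vle_autE.
Qed.

Lemma disjoint_subtrees p q x : depth p = depth q -> p <> q ->
  vle p x -> ~ vle q x.
Proof. by move=> pq npq px /(vle_depth_eq pq px). Qed.

Lemma supported_commute p q r t : depth p = depth q -> p <> q ->
  supported p r -> supported q t -> commute r t.
Proof.
move=> pq npq rp tq; apply: autP => x; rewrite !aut_mulE.
have [px|px] := pselect (vle p x).
  rewrite !tq //; apply: (disjoint_subtrees pq npq) => //.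
  by apply/supported_stable.
rewrite (rp _ px) rp //; move=> ptx; apply: px.
have ntx : ~ vle q (t x) by exact: (disjoint_subtrees pq npq).
by rewrite -(tq x) // => /(supported_stable x tq).
Qed.

Lemma agreeM v g h g' h' : h v = v ->
  agree v g' g -> agree v h' h -> agree v (g' * h') (g * h).
Proof.
move=> hv gg hh x vx; rewrite !aut_mulE hh // gg //.
by rewrite -[X in vle X _]hv vle_autE.
Qed.

Lemma agree_fix v g h : agree v g h -> h v = v -> g v = v.
Proof. by move=> gh hv; rewrite gh //; exact: vle_refl. Qed.

Lemma agreeV v g g' : g v = v -> agree v g' g -> agree v g'^-1 g^-1.
Proof.
move=> gv gg x vx; apply: (can_inj (aut_VK g')); rewrite aut_KV gg ?aut_KV //.
by rewrite -[v](aut_inv_fix gv) vle_autE.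
Qed.

Lemma agreeJ v g h g' h' : g v = v -> h v = v ->
  agree v g' g -> agree v h' h -> agree v (g' ^ h') (g ^ h).
Proof.
move=> gv hv gg hh; rewrite !conjgE; apply: agreeM; last exact: agreeM.
  by rewrite aut_mulE hv.
exact: agreeV.
Qed.

Lemma agreeR v g h g' h' : g v = v -> h v = v ->
  agree v g' g -> agree v h' h -> agree v [~ g', h'] [~ g, h].
Proof.
move=> gv hv gg hh; apply: agreeM; [|exact: agreeV|exact: agreeJ].
by rewrite conjgE !aut_mulE hv gv -[in LHS]hv aut_VK.
Qed.

(** Lets an element of G be traded for one of H with the same section when conjugating. *)
Lemma supportedJ_agree v r g g' : supported v r -> g v = v -> agree v g' g ->
  r ^ g = r ^ g'.
Proof.
move=> rv gv gg; apply: autP => x; have [vx|vx] := pselect (vle v x).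
  exact/esym/(agreeJ (supported_fix rv) gv).
have g'v := agree_fix gg gv; rewrite !(@supportedJ v) // => gx; apply: vx.
  by rewrite -(aut_inv_fix g'v).
by rewrite -(aut_inv_fix gv).
Qed.

Lemma fixR v g h : g v = v -> h v = v -> [~ g, h] v = v.
Proof.
move=> gv hv; rewrite -[[~ g, h]]/(g^-1 * (h^-1 * (g * h))) !aut_mulE.
by rewrite hv gv !aut_inv_fix.
Qed.

(* [~ a, r] = r^-1 ^ a * r, and the first factor, being supported in another
   subtree of the same level, commutes with r and t. *)
Lemma double_commutator p a r t : a p <> p -> supported p r -> supported p t ->
  [~ [~ a, r], t] = [~ r, t].
Proof.
move=> ap rp tp; set s := (r^-1) ^ a.
have arE : [~ a, r] = s * r by rewrite /s conjgE -!mulgA.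
have sp : supported (a^-1 p) s by apply: supportedJ; exact: supportedV.
have sc (x : aut T) : supported p x -> commute s x.
  apply: supported_commute sp; first by rewrite depth_aut.
  by move=> ap'; apply: ap; rewrite -[in LHS]ap' aut_KV.
have st : s ^ t = s by rewrite conjgE (sc t tp) mulKg.
by rewrite arE commgEl conjMg st invgM mulgA mulgVK -commgEl.
Qed.

(** The double commutator stays in any subgroup containing [a] and normalised by [r'] and [t'],
    although only the sections of [r'] and [t'] at [v] are prescribed. *)
Lemma agree_double_commutator v p a r t r' t' :
  vle v p -> a v = v -> a p <> p -> supported p r -> supported p t ->
  agree v r' r -> agree v t' t -> agree v [~ [~ a, r'], t'] [~ r, t].
Proof.
move=> vp av ap rp tp rr tt; rewrite -(double_commutator ap rp tp).
have rv := supported_above vp rp; apply: agreeR tt => //.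
- exact: fixR.
- exact: supported_above tp.
- exact: agreeR.
Qed.

End Supports.

(** * Iterated commutators in rigid stabilisers *)

Section WeaklyBranch.
Variables (T : rootedTree) (G : set (aut T)).
Hypothesis cG : group_closed (mem G).
Hypothesis rist_neq1 : forall v, rist G v <> [set 1].
Implicit Types (v w x y p q : T) (a b g h r t : aut T).

Lemma rist_supported p g : rist G p g -> supported p g.
Proof. by case. Qed.

Lemma rist_closed p : group_closed (mem (rist G p)).
Proof.
apply: group_closedP => [|x [Gx xp]|x y [Gx xp] [Gy yp]].
- by split=> //; exact: closed1.
- by split; [exact: closedV | exact: supportedV].
- by split; [exact: closedM | exact: supportedM].
Qed.

Lemma rist_sub p q : vle p q -> rist G q `<=` rist G p.
Proof. by move=> pq g [Gg gq]; split=> //; exact: supported_vle gq. Qed.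

Lemma aut_neq1 g : g <> 1 -> exists x, g x <> x.
Proof.
move=> g1; apply: contrapT => /forallNP gx; apply: g1; apply: autP => x.
by apply: contrapT; exact: gx.
Qed.

Lemma supported_moved p g x : supported p g -> g x <> x -> vle p x.
Proof. by move=> gp gx; apply: contrapT => /gp. Qed.

Lemma rist_move p : exists g x, [/\ rist G p g, vle p x & g x <> x].
Proof.
have [g [gp /aut_neq1[x gx]]] : exists g, rist G p g /\ g <> 1.
  apply: contrapT => /forallNP rist1; apply: (@rist_neq1 p).
  apply/seteqP; split=> [g gp|_ ->].
    by apply: contrapT => g1; exact: (rist1 g).
  exact: closed1 (rist_closed p).
by exists g, x; split=> //; exact: supported_moved (rist_supported gp) gx.
Qed.

(** Single commutators, not the subgroups they generate: a non-trivial element of stage [k.+1]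
    exhibits two non-commuting elements of stage [k]. *)
Fixpoint iterated_commutators k p : set (aut T) :=
  if k is k'.+1 then
    [set [~ c, d] | c in iterated_commutators k' p
                  & d in iterated_commutators k' p]
  else rist G p.

Lemma iterated_commutators_rist k p : iterated_commutators k p `<=` rist G p.
Proof.
elim: k => //= k IHk _ [c /IHk cp [d /IHk dp <-]].
exact: closedR (rist_closed p) _ _ cp dp.
Qed.

(* Conjugating by an element of the k-th commutators that moves q' pushes the
   support of r away from the subtree at q', so that one more commutator still
   realises r there. *)
Lemma iterated_commutators_agree k p : exists2 q, vle p q &
  forall r, rist G q r -> exists2 d, iterated_commutators k p d & agree q d r.
Proof.
elim: k => [|k [q pq IHq]].
  by exists p => [|r rp]; [exact: vle_refl | exists r].
have [f [q' [fq qq' fq']]] := rist_move q.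
exists q' => [|r rq']; first exact: vle_trans qq'.
have [d Dd df] := IHq _ fq.
(* The commutator is [c^-1 * c ^ d] with [c ^ d] trivial below [q'], so [c] has to realise
   [r^-1]. *)
have rVq' := closedV (rist_closed q') rq'.
have [c Dc cr] := IHq _ (rist_sub qq' rVq').
exists [~ c, d]; first by exists c => //; exists d.
move=> x q'x; have qx := vle_trans qq' q'x.
have dxE := df _ qx.
have cdx : c (d x) = d x.
  rewrite dxE cr; last by rewrite supported_stable //; exact: rist_supported.
  apply: (rist_supported rVq'); apply: (@disjoint_subtrees _ (f q')).
  - by rewrite depth_aut.
  - by [].
  - by rewrite vle_autE.
rewrite commgEl conjgE !aut_mulE cdx aut_VK -[r]invgK; apply: agreeV qx => //.
exact: supported_above qq' (rist_supported rVq').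
Qed.

Lemma iterated_commutators_neq1 k p :
  exists2 d, iterated_commutators k p d & d <> 1.
Proof.
have [q _ Dq] := iterated_commutators_agree k p.
have [r [x [rq qx rx]]] := rist_move q; have [d Dd dr] := Dq r rq.
by exists d => // d1; apply: rx; rewrite -dr // d1.
Qed.

(** * Non-trivial rigid stabilisers in dense subgroups with full sections *)

Variable H : set (aut T).
Variable n : nat.
Hypothesis cH : group_closed (mem H).
Hypothesis H_dense : forall g m, G g ->
  exists2 h, H h & forall x, (depth x <= m)%N -> h x = g x.
Hypothesis H_section : forall v g, depth v = n -> G g -> g v = v ->
  exists2 h, H h & agree v h g.

Definition ball_stab : set (aut T) :=
  [set k | H k /\ forall x, (depth x <= n)%N -> k x = x].

Definition multi_rist (s : seq T) : set (aut T) :=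
  [set k | ball_stab k /\
    forall x, (forall v, v \in s -> ~ vle v x) -> k x = x].

Lemma ball_stab_closed : group_closed (mem ball_stab).
Proof.
apply: group_closedP => [|k [Hk kE]|k l [Hk kE] [Hl lE]]; split=> //.
- exact: closed1.
- exact: closedV.
- by move=> x /kE kx; rewrite -[in LHS]kx aut_VK.
- exact: closedM.
- by move=> x xn; rewrite aut_mulE lE // kE.
Qed.

Lemma ball_stabJ k h : ball_stab k -> H h -> ball_stab (k ^ h).
Proof.
move=> [Hk kE] Hh; split; first exact: closedJ.
by move=> x xn; rewrite conjgE !aut_mulE kE ?depth_aut // aut_VK.
Qed.

Lemma ball_stabR k h : ball_stab k -> H h -> ball_stab [~ k, h].
Proof.
move=> Kk Hh; apply: (closedM ball_stab_closed); last exact: ball_stabJ.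
exact: closedV ball_stab_closed _ Kk.
Qed.

Lemma multi_rist_closed s : group_closed (mem (multi_rist s)).
Proof.
apply: group_closedP => [|k [Hk kE]|k l [Hk kE] [Hl lE]]; split=> //.
- exact: closed1 ball_stab_closed.
- exact: closedV ball_stab_closed _ Hk.
- by move=> x /kE kx; rewrite -[in LHS]kx aut_VK.
- exact: closedM ball_stab_closed _ _ Hk Hl.
- by move=> x xs; rewrite aut_mulE lE // kE.
Qed.

Lemma multi_ristJ s b k : {in s, forall v, depth v = n} ->
  multi_rist s b -> ball_stab k -> multi_rist s (b ^ k).
Proof.
move=> sn [[Hb bK] bs] [Hk kE]; split; first by apply: ball_stabJ.
move=> x xs; rewrite conjgE !aut_mulE bs ?aut_VK // => v vs.
by rewrite -[v]kE ?sn // vle_autE; exact: xs.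
Qed.

Lemma multi_ristR s b k : {in s, forall v, depth v = n} ->
  multi_rist s b -> ball_stab k -> multi_rist s [~ b, k].
Proof.
move=> sn Kb Kk; apply: (closedM (multi_rist_closed s)).
  exact: closedV (multi_rist_closed s) _ Kb.
exact: multi_ristJ.
Qed.

(** [ball_stab] is normalised by H, so double commutators of [a] with elements of H of prescribed
    sections remain in it. *)
Lemma ball_stab_section v p a c : depth v = n -> vle v p ->
  ball_stab a -> a p <> p -> iterated_commutators 1 p c ->
  exists2 k, ball_stab k & agree v k c.
Proof.
move=> vn vp Ka ap [r rp [t tp <-]].
have rs := rist_supported rp; have ts := rist_supported tp.
have [r' Hr' rr] := H_section vn rp.1 (supported_above vp rs).
have [t' Ht' tt] := H_section vn tp.1 (supported_above vp ts).
exists [~ [~ a, r'], t']; first by do 2?apply: ball_stabR.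
by apply: (agree_double_commutator vp) => //; apply: Ka.2; rewrite vn.
Qed.

(** Elements of H may move the vertices of [s], so the elements commuted with [a] are now taken in
    [ball_stab]; this costs one more stage of commutators. *)
Lemma multi_rist_section s v p a c : {in s, forall w, depth w = n} ->
  depth v = n -> vle v p ->
  multi_rist s a -> a p <> p -> iterated_commutators 2 p c ->
  exists2 b, multi_rist s b & agree v b c.
Proof.
move=> sn vn vp Ka ap [r rp [t tp <-]].
have rs := rist_supported (@iterated_commutators_rist 1 _ _ rp).
have ts := rist_supported (@iterated_commutators_rist 1 _ _ tp).
have [r' Hr' rr] := ball_stab_section vn vp Ka.1 ap rp.
have [t' Ht' tt] := ball_stab_section vn vp Ka.1 ap tp.
exists [~ [~ a, r'], t']; first by do 2?apply: multi_ristR.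
by apply: (agree_double_commutator vp) => //; apply: Ka.1.2; rewrite vn.
Qed.

Lemma ball_stab_neq1 : exists2 k, ball_stab k & k <> 1.
Proof.
(* Strictly below level [n], so that the rigid stabiliser of [v] fixes the whole [n]-ball. *)
have [v nv] := exists_deep T n.+1.
have [g [x [gv vx gx]]] := rist_move v.
have [h Hh hg] := H_dense (depth x) gv.1.
exists h => [|h1]; last by apply: gx; rewrite -hg // h1.
have nx : (n <= depth x)%N by apply: ltnW (leq_trans nv (vle_depth vx)).
split=> // y yn; rewrite hg; last exact: leq_trans nx.
apply: (rist_supported gv) => /vle_depth.
by rewrite leqNgt (leq_ltn_trans yn).
Qed.

Lemma level_seq : exists s : seq T, forall v, v \in s <-> depth v = n.
Proof.
have /finite_seqP[s sE] : finite_set [set v : T | depth v = n].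
  by apply: sub_finite_set (finite_ball T n) => v /= ->.
exists s => v; split=> [vs|vn]; last first.
  by have: [set v : T | depth v = n] v by []; rewrite sE.
by have: [set` s] v by []; rewrite -sE.
Qed.

(** Induction step standing in for the minimal set S: by the two triviality hypotheses, an element
    of [multi_rist (v :: s)] acting trivially below [v], or only below [v], is trivial. *)
Lemma multi_rist_trivial_cons v s :
  depth v = n -> {in s, forall w, depth w = n} ->
  (forall b, rist H v b -> b = 1) -> (forall b, multi_rist s b -> b = 1) ->
  forall b, multi_rist (v :: s) b -> b = 1.
Proof.
move=> vn sn rist1 IHs a Ka; apply: contrapT => a1.
have vsn : {in v :: s, forall w, depth w = n}.
  by move=> w; rewrite inE => /orP[/eqP->|/sn].
have off_v c : multi_rist (v :: s) c -> agree v c 1 -> c = 1.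
  move=> [Kc cs] cv; apply: IHs; split=> // x xs.
  have [/cv//|vx] := pselect (vle v x).
  by apply: cs => w; rewrite inE => /orP[/eqP->//|/xs].
have in_v c : multi_rist (v :: s) c -> supported v c -> c = 1.
  by move=> [[Hc _] _] cv; exact: rist1.
have [p0 [vp0 ap0]] : exists p0, vle v p0 /\ a p0 <> p0.
  apply: contrapT => /forallNP av; apply/a1/off_v => // x vx.
  by apply: contrapT => ax; exact: (av x).
(* Going down from [p0] yields a [p] moved by [g]; it is still moved by [a], which would otherwise
   fix the ancestor [p0]. *)
have [g [p [gp0 p0p gp]]] := rist_move p0.
have vp := vle_trans vp0 p0p.
have ap : a p <> p.
  move=> ap; apply: ap0; apply: (vle_depth_eq _ _ p0p); first exact: depth_aut.
  by rewrite -ap vle_autE.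
(* Stage 3, so that [d1] and [d2] lie in stage 2, which [multi_rist_section] realises. *)
have [_ [d1 Dd1 [d2 Dd2 <-]] d12] := iterated_commutators_neq1 3 p.
have [b1 Kb1 bd1] := multi_rist_section vsn vn vp Ka ap Dd1.
have [b2 Kb2 bd2] := multi_rist_section vsn vn vp Ka ap Dd2.
have rd1 := @iterated_commutators_rist 2 _ _ Dd1.
have rd2 := @iterated_commutators_rist 2 _ _ Dd2.
have sd1 := rist_supported rd1; have sd2 := rist_supported rd2.
have d1v := supported_above vp sd1; have d2v := supported_above vp sd2.
have Kb12 := closedR (multi_rist_closed _) Kb1 Kb2.
have bd12 := agreeR d1v d2v bd1 bd2.
have b12 : [~ b1, b2] <> 1.
  move=> b12; apply: d12; apply: autP => x.
  have [vx|vx] := pselect (vle v x); first by rewrite -bd12 // b12.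
  have sR := rist_supported (closedR (rist_closed p) rd1 rd2).
  exact: (supported_vle vp sR).
have [x [vx b12x]] : exists x, ~ vle v x /\ [~ b1, b2] x <> x.
  apply: contrapT => /forallNP bv; apply/b12/in_v => // x vx.
  by apply: contrapT => bx; exact: (bv x).
(* Close to g, the element h moves the subtree at p off itself, but acts
   trivially outside the subtree at v up to the depth of x: there
   [~ b1, b2 ^ h] looks like [~ b1, b2], while at v it vanishes. *)
have [h Hh hg] := H_dense (maxn n (maxn (depth p) (depth x))) gp0.1.
have gv := supported_above vp0 (rist_supported gp0).
(* Within the [n]-ball the subtree at [v] is reduced to [v], which [g] fixes. *)
have Kh : ball_stab h.
  split=> // y yn; rewrite hg ?leq_max ?yn //.
  have [vy|vy] := pselect (vle v y).
    suff -> : y = v by [].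
    apply/esym/(vle_depth_eq _ vy (vle_refl y))/eqP.
    by rewrite eqn_leq vn yn -vn vle_depth.
  exact: (supported_vle vp0 (rist_supported gp0)).
have hv : h v = v by apply: Kh.2; rewrite vn.
have Kb2h := multi_ristJ vsn Kb2 Kh.
pose c := [~ b1, b2 ^ h].
have Kc : multi_rist (v :: s) c := closedR (multi_rist_closed _) Kb1 Kb2h.
have c1 : c = 1.
  apply: off_v => //.
  (* The supports lie below [p] and [h^-1 p], which differ because [h] moves [p] as [g] does. *)
  have -> : 1 = [~ d1, d2 ^ h].
    apply/esym/eqP/commgP.
    apply: (supported_commute _ _ sd1 (supportedJ sd2)).
      by rewrite depth_aut.
    move=> ph; apply: gp; rewrite -hg ?leq_max ?leqnn ?orbT //.
    by rewrite [in LHS]ph aut_KV.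
  apply: agreeR => //; last exact: agreeJ.
  by rewrite conjgE !aut_mulE hv d2v aut_inv_fix.
apply: b12x.
have off y : depth y = depth x -> ~ vle v y -> (b2 ^ h) y = b2 y.
  move=> yx vy.
  have hfix z : depth z = depth x -> ~ vle v z -> h z = z.
    move=> zx vz; rewrite hg ?zx ?leq_max ?leqnn ?orbT //.
    exact: (supported_vle vp0 (rist_supported gp0)).
  rewrite conjgE !aut_mulE hfix //.
  have b2v : b2 v = v by apply: Kb2.1.2; rewrite vn.
  rewrite -[in LHS](hfix (b2 y)) ?aut_VK ?depth_aut //.
  by rewrite -[X in vle X _]b2v vle_autE.
(* It remains to compare [b1 (b2 x)] with [b2 (b1 x)]: in both, [b2] is applied outside the subtree
   at [v] and at the depth of [x], where it equals [b2 ^ h], which commutes with [b1]. *)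
apply: (can_inj (aut_VK (b2 * b1))).
rewrite -[LHS]/((b2 * b1 * [~ b1, b2]) x) -commgC !aut_mulE.
have b1v : b1 v = v by apply: Kb1.1.2; rewrite vn.
have b1x : ~ vle v (b1 x) by rewrite -[X in vle X _]b1v vle_autE.
rewrite -(off x) // -(off (b1 x)) ?depth_aut // -[LHS]/((b1 * b2 ^ h) x).
by have /eqP/commgP-> := c1.
Qed.

(** Otherwise triviality of [multi_rist] propagates from the empty sequence to the whole level,
    where it contains [ball_stab]. *)
Lemma rist_dense_neq1 : exists v, depth v = n /\ rist H v <> [set 1].
Proof.
apply: contrapT => /forallNP rist1.
have riste v b : depth v = n -> rist H v b -> b = 1.
  move=> vn bv; have [//|b1] := pselect (b = 1); exfalso; apply: (rist1 v).
  by split=> // rE; apply: b1; rewrite rE in bv.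
have triv s : {in s, forall w, depth w = n} ->
    forall b, multi_rist s b -> b = 1.
  elim: s => [_ b [_ bE]|v s IHs vsn]; first by apply: autP => x; exact: bE.
  have vn : depth v = n by apply: vsn; rewrite mem_head.
  have sn : {in s, forall w, depth w = n}.
    by move=> w ws; apply: vsn; rewrite inE ws orbT.
  by apply: multi_rist_trivial_cons => // [b|]; [exact: riste | exact: IHs].
have [k Kk k1] := ball_stab_neq1; apply: k1.
have [s sE] := level_seq; apply: (triv s) => [w /sE//|].
split=> // x xs; apply: Kk.2; rewrite leqNgt; apply/negP => /ltnW/ancestor.
by move=> [v vx /sE/xs].
Qed.

End WeaklyBranch.

(** * Prodense subgroups and the core argument *)

Section ProdenseSubgroups.
Variable T : rootedTree.
Implicit Types (G H : set (aut T)) (u v x : T) (g h : aut T).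

(** The stabiliser in G of the [m]-ball is normal, and non-trivial by [ball_stab_neq1] with G in the
    role of H. *)
Lemma prodense_dense G H g m :
  weakly_branch G -> prodense H G -> G g ->
  exists2 h, H h & forall x, (depth x <= m)%N -> h x = g x.
Proof.
move=> [_ cG _ ristG] dH Gg.
have nK : normal_subgroup (ball_stab G m) G.
  split; first by split; [exact: ball_stab_closed | move=> k []].
  by move=> h k Gh Kk; exact: ball_stabJ.
have K1 : ball_stab G m <> [set 1].
  move=> K1; have [|k] := @ball_stab_neq1 _ _ cG ristG G m.
    by move=> h k Gh; exists h.
  by rewrite K1.
move: Gg; rewrite -(dH _ nK K1) => -[h Hh [k [_ kE] <-]].
by exists h => // x xm; rewrite aut_mulE kE.
Qed.

Lemma vertex_section_agree G H u g :
  vertex_section H u = vertex_section G u -> G g -> g u = u ->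
  exists2 h, H h & agree u h g.
Proof.
move=> HG Gg gu.
have : vertex_section G u (restr gu).
  by exists g, (conj Gg gu); apply: autP => w; exact: val_inj.
rewrite -HG => -[h [[Hh hu] gh]]; exists h => // x ux.
pose w : subtree u := SigSub (mem_set ux).
exact: esym (congr1 (fun f : aut (subtree u) => \val (f w)) gh).
Qed.

Lemma vertex_section_closed G u :
  group_closed (mem G) -> group_closed (mem (vertex_section G u)).
Proof.
move=> cG; apply: group_closedP.
- exists 1, (conj (closed1 cG) (erefl u)).
  by apply: autP => w; exact: val_inj.
- move=> _ [g [[Gg gu] ->]].
  exists g^-1, (conj (closedV cG Gg) (aut_inv_fix gu)).
  by apply: autP => w; exact: val_inj.
- move=> _ _ [g [[Gg gu] ->]] [h [[Gh hu] ->]].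
  have ghu : (g * h) u = u by rewrite aut_mulE hu.
  exists (g * h), (conj (closedM cG Gg Gh) ghu).
  by apply: autP => w; exact: val_inj.
Qed.

Lemma vertex_section_sub G H u :
  H `<=` G -> vertex_section H u `<=` vertex_section G u.
Proof.
move=> HG _ [h [[Hh hu] ->]]; exists h, (conj (HG _ Hh) hu).
by apply: autP => w; exact: val_inj.
Qed.

(** By density some [y] in H takes [u] to [v]; conjugating by it carries the equality of sections
    from [u] to [v]. *)
Lemma section_transport G H u v g :
  weakly_branch G -> subgroup H G -> prodense H G ->
  vertex_section H u = vertex_section G u -> depth v = depth u ->
  G g -> g v = v -> exists2 h, H h & agree v h g.
Proof.
move=> wG [cH HG] dH HGu vu Gg gv; have [_ cG trG _] := wG.
have uL := level_depth u.
have vL : level (depth u) v by rewrite -vu; exact: level_depth.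
have [g0 Gg0 g0u] := trG _ _ _ uL vL.
have [y Hy yg0] := prodense_dense (depth u) wG dH Gg0.
have yu : y u = v by rewrite yg0.
have yv : y^-1 v = u by rewrite -yu aut_VK.
have [|h Hh hg] := vertex_section_agree HGu (closedJ cG Gg (HG _ Hy)).
  by rewrite conjgE !aut_mulE yu gv.
exists (h ^ y^-1); first by apply: closedJ => //; exact: closedV.
move=> x vx; rewrite conjgE !aut_mulE invgK hg; last by rewrite -yv vle_autE.
by rewrite conjgE !aut_mulE !aut_KV.
Qed.

Lemma proper_section G H u :
  weakly_branch G -> subgroup H G -> prodense H G ->
  vertex_section H u = vertex_section G u -> H = G.
Proof.
move=> wG sH dH HGu; have [cH HG] := sH; have [_ cG _ ristG] := wG.
have Hdense g m := @prodense_dense G H g m wG dH.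
have Hsec v g := @section_transport G H u v g wG sH dH HGu.
have [v [vu Hv]] := rist_dense_neq1 cG ristG cH Hdense Hsec.
(* The normal core of H in G. *)
pose N := [set x : aut T | forall g, G g -> H (x ^ g)].
have NH : N `<=` H by move=> x /(_ 1 (closed1 cG)); rewrite conjg1.
have nN : normal_subgroup N G.
  split=> [|g x Gg Nx h Gh]; last by rewrite -conjgM; apply: Nx; exact: closedM.
  split; last by move=> x /NH/HG.
  apply: group_closedP => [g _|x Nx g Gg|x y Nx Ny g Gg].
  - by rewrite conj1g; exact: closed1.
  - by rewrite conjVg; apply: closedV => //; exact: Nx.
  - by rewrite conjMg; apply: closedM => //; [exact: Nx | exact: Ny].
have N1 : N <> [set 1].
  move=> N1; apply: Hv; apply/seteqP; split=> [x [Hx xv]|_ ->]; last first.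
    exact: closed1 (rist_closed cH v).
  rewrite -N1 => g Gg.
  (* Writes [g] as [h * k] with [k] fixing [w]. As [x ^ h] is supported below [w], conjugating it by
     [k] or by a [t] in H with the same section at [w] gives the same result. *)
  have [h Hh hg] := Hdense g (depth v) Gg.
  set k := h^-1 * g; set w := h^-1 v.
  have kw : k w = w by rewrite aut_mulE -hg ?depth_aut // aut_VK.
  have Gk : G k by apply: closedM => //; apply: closedV => //; exact: HG.
  have [t Ht tk] := Hsec w k (etrans (depth_aut _ _) vu) Gk kw.
  have -> : x ^ g = (x ^ h) ^ k by rewrite -conjgM mulVKg.
  rewrite (supportedJ_agree (supportedJ xv) kw tk).
  by do 2?apply: closedJ.
have NG := dH N nN N1.
apply/seteqP; split=> // g; rewrite -{1}NG => -[h Hh [k /NH Hk <-]].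
exact: closedM.
Qed.

End ProdenseSubgroups.


Theorem theorem3p2 (T : rootedTree) (G H : set (aut T)) (u : T) :
  weakly_branch G -> subgroup H G -> prodense H G ->
  (proper_subgroup H G <->
   proper_subgroup (vertex_section H u) (vertex_section G u)).
Proof.
move=> wG sH dH; split=> [[_ HG]|[_ sHG]]; split=> //.
- split; first exact: vertex_section_closed sH.1.
  exact: vertex_section_sub sH.2.
- by move=> eHG; apply: HG; exact: proper_section eHG.
- by move=> eHG; apply: sHG; rewrite eHG.
Qed.
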